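(* Let $(A,\cdot)$ be an associative algebra and $\mathcal B$ a nondegenerate commutative Connes cocycle on $(A,\cdot)$. Then there exists a compatible anti-dendriform algebra structure $(A,\vartriangleright,\vartriangleleft)$ on $(A,\cdot)$ defined by $$\mathcal B(x\vartriangleright y,z)=-\mathcal B(y,z\cdot x),\qquad \mathcal B(x\vartriangleleft y,z)=-\mathcal B(x,y\cdot z),\qquad \forall x,y,z\in A.$$
   Context: All vector spaces are finite-dimensional over a field $\mathbb F$ of characteristic $0$. Associative algebras are not assumed to be unital. Commutative Connes cocycle on an associative algebra $(A,\cdot)$: a symmetric bilinear form $\mathcal B$ on $A$ with $\mathcal B(x\cdot y,z)+\mathcal B(y\cdot z,x)+\mathcal B(z\cdot x,y)=0$ for all $x,y,z\in A$. Anti-dendriform algebra: a vector space $A$ with two bilinear operations $\vartriangleright,\vartriangleleft$ such that, with $x\cdot y=x\vartriangleright y+x\vartriangleleft y$, for all $x,y,z\in A$, $$x\vartriangleright(y\vartriangleright z)=-(x\cdot y)\vartriangleright z=-x\vartriangleleft(y\cdot z)=(x\vartriangleleft y)\vartriangleleft z,\qquad (x\vartriangleright y)\vartriangleleft z=x\vartriangleright(y\vartriangleleft z).$$ A compatible anti-dendriform algebra structure on an associative algebra $(A,\cdot)$ is an anti-dendriform algebra $(A,\vartriangleright,\vartriangleleft)$ on the same vector space with $x\cdot y=x\vartriangleright y+x\vartriangleleft y$ for all $x,y\in A$. *)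

(* Defs.v *)
From HB Require Import structures.
From mathcomp Require Import all_boot all_order all_algebra.

Set Implicit Arguments.
Unset Strict Implicit.
Unset Printing Implicit Defensive.

Import GRing.Theory.
Local Open Scope ring_scope.

(* Algebras are given by a bilinear product on a vectType rather than by
   lalgType/falgType, since those are unital. *)

Section Algebras.
Variables (F : fieldType) (A : vectType F).

(* Symmetry and bilinearity of the form are carried by {symmetric A}. *)
Definition commutative_Connes_cocycle
    (mul : {bilinear A -> A -> A}) (B : {symmetric A}) : Prop :=
  forall x y z : A, B (mul x y) z + B (mul y z) x + B (mul z x) y = 0.

Record anti_dendriform (rt lt : {bilinear A -> A -> A}) : Prop := {
  anti_dendriform_rt_mul : forall x y z : A,
    rt x (rt y z) = - rt (rt x y + lt x y) z;
  anti_dendriform_mul_lt : forall x y z : A,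
    - rt (rt x y + lt x y) z = - lt x (rt y z + lt y z);
  anti_dendriform_lt_lt : forall x y z : A,
    - lt x (rt y z + lt y z) = lt (lt x y) z;
  anti_dendriform_rt_lt : forall x y z : A,
    lt (rt x y) z = rt x (lt y z)
}.

Definition compatible_anti_dendriform
    (mul rt lt : {bilinear A -> A -> A}) : Prop :=
  anti_dendriform rt lt /\ forall x y : A, mul x y = rt x y + lt x y.

End Algebras.

(* Main.v *)
Require Import Defs.
From HB Require Import structures.
From mathcomp Require Import all_boot all_order all_algebra.
From mathcomp Require Import ring.

Set Implicit Arguments.
Unset Strict Implicit.
Unset Printing Implicit Defensive.

Import GRing.Theory.
Local Open Scope ring_scope.

(** Nondegeneracy in finite dimension makes the map sending [v] to [B v] an
    isomorphism from [A] onto its dual.  Hence the two displayed formulas define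
    unique bilinear operations ([bilinear_of_form]), and an identity between
    elements of [A] may be tested by pairing both sides with an arbitrary [w]
    ([nondegenerate_injl]).

    Moving factors across [B] with these formulas turns each side of an
    anti-dendriform axiom, paired with [w], into a value [B a (b c d)] where
    [a b c d] is a rotation of the single cyclic word [x y z w].  In three of
    the four axioms both sides give the same rotation, and associativity of the
    product concludes.  The remaining one, [- rt (x y) z = - lt x (y z)],
    compares [B z (w x y)] with [B x (y z w)], two rotations that differ by two
    steps; [cocycle_rotate2] shows that they agree, from the cocycle identity
    and the invertibility of [2].  That the two operations add up to the product
    is the cocycle identity read against an arbitrary [z]. *)

Section Duality.
Variables (F : fieldType) (A : vectType F) (B : {symmetric A}).

Lemma symmetric_formC x y : B x y = B y x.
Proof. by rewrite hermC expr0 mul1r. Qed.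

Hypothesis B_nondeg : nondegenerate B.

Lemma nondegenerate_injl u v : (forall z, B u z = B v z) -> u = v.
Proof.
move=> eq_uv; apply/eqP; rewrite -subr_eq0 -memv0 -(eqP B_nondeg).
by apply/mem_orthovP => z _; rewrite linearBl /= eq_uv subrr.
Qed.

(** The map from [A] to its dual given by [B] is injective by nondegeneracy,
    hence onto since the two spaces have the same dimension.  The conclusion is
    a sigma type so that the representing vector can be used as a function of
    [phi]. *)
Lemma nondegenerate_represents (phi : A -> F) :
  scalar phi -> {v | forall z, B v z = phi z}.
Proof.
move=> phi_linear.
pose flat (v : A) : 'Hom(A, F^o) := linfun (B v : A -> F^o).
have flatE v z : flat v z = B v z by rewrite lfunE.
have flat_linear : linear flat.
  by move=> a u v; apply/lfunP => z; rewrite !lfunE /= !lfunE /= !flatE linearPl.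
pose Lf := GRing.isLinear.Build F A 'Hom(A, F^o) _ flat flat_linear.
pose flatL : {linear A -> 'Hom(A, F^o)} := HB.pack flat Lf.
pose Lp := GRing.isLinear.Build F A F^o _ phi phi_linear.
pose phiL : {linear A -> F^o} := HB.pack phi Lp.
have flat_inj : lker (linfun flatL) == 0%VS.
  apply/lker0P => u v; rewrite !lfunE /= => eq_uv.
  by apply: nondegenerate_injl => z; rewrite -!flatE eq_uv.
have flat_surj : limg (linfun flatL) = fullv.
  apply/eqP; rewrite eqEdim subvf limg_dim_eq ?(eqP flat_inj) ?capv0 //=.
  (* The dimension of 'Hom(A, F^o) unfolds to dim A * 1. *)
  by rewrite !dimvf [dim _]muln1.
exists ((linfun flatL)^-1%VF (linfun phiL)) => z.
rewrite -flatE; have -> v : flat v = linfun flatL v by rewrite lfunE.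
by rewrite limg_lfunVK ?flat_surj ?memvf // lfunE.
Qed.

(** Bilinearity of the operation is inherited from [T], because an identity
    between vectors can be tested by pairing. *)
Lemma bilinear_of_form (T : A -> A -> A -> F) :
    (forall y z, scalar (fun x => T x y z)) ->
    (forall x z, scalar (fun y => T x y z)) ->
    (forall x y, scalar (T x y)) ->
  exists op : {bilinear A -> A -> A}, forall x y z, B (op x y) z = T x y z.
Proof.
move=> T_lin1 T_lin2 T_lin3.
pose op x y := sval (nondegenerate_represents (T_lin3 x y)).
have opE x y z : B (op x y) z = T x y z by rewrite /op; case: nondegenerate_represents.
have op_bilinear : bilinear_for
    (GRing.Scale.Law.clone _ _ *:%R _) (GRing.Scale.Law.clone _ _ *:%R _) op.
  by split=> [y|x] a u v; apply: nondegenerate_injl => z;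
    rewrite linearPl /= !opE ?T_lin1 ?T_lin2.
pose opM := bilinear_isBilinear.Build F A A A _ _ op op_bilinear.
pose opL : {bilinear A -> A -> A} := HB.pack op opM.
by exists opL.
Qed.

End Duality.

Section Cyclic.
Variables (F : fieldType) (A : vectType F).
Variables (mul : {bilinear A -> A -> A}) (mulA : associative mul).
Variables (B : {symmetric A}) (B_cocycle : commutative_Connes_cocycle mul B).

(** Write [Ta], [Tb], [Tc], [Td] for the pairings of each letter of the cyclic
    word [a b c d] with the product of the three letters that follow it, and
    [P], [Q] for the pairings [B (c d) (a b)] and [B (d a) (b c)] of its two
    halves.  The cocycle identity applied to two letters grouped together and
    the two others gives [Tc + P + Td = 0], [Td + Q + Ta = 0],
    [Ta + P + Tb = 0] and [Tb + Q + Tc = 0]; eliminating [P], [Q], [Tb] and [Td]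
    leaves [2 (Ta - Tc) = 0]. *)
Lemma cocycle_rotate2 : 2%:R != 0 :> F -> forall a b c d,
  B a (mul (mul b c) d) = B c (mul (mul d a) b).
Proof.
move=> nz2 a b c d.
have rot p q r s : B s (mul (mul p q) r) + B (mul r s) (mul p q)
    + B r (mul (mul s p) q) = 0.
  by rewrite -(B_cocycle (mul p q) r s) mulA; congr (_ + _ + _);
    apply: symmetric_formC.
have := (rot a b c d, rot b c d a, rot c d a b, rot d a b c).
rewrite (symmetric_formC B (mul a b)) (symmetric_formC B (mul b c)).
set Ta := B a _; set Tb := B b _; set Tc := B c _; set Td := B d _.
set P := B (mul c d) _; set Q := B (mul d a) _.
move=> [[[e1 e2] e3] e4].
apply/eqP; rewrite -subr_eq0; apply/eqP; apply: (mulfI nz2).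
rewrite mulr0.
transitivity ((Ta + Q + Td) - (Td + P + Tc) + (Tb + P + Ta) - (Tc + Q + Tb)); first by ring.
by rewrite e1 e2 e3 e4 subrr addr0 subr0.
Qed.
End Cyclic.

Theorem theorem2p27 (F : fieldType) (charF0 : [pchar F] =i pred0)
    (A : vectType F) (mul : {bilinear A -> A -> A}) (mulA : associative mul)
    (B : {symmetric A}) (B_nondeg : nondegenerate B)
    (B_cocycle : commutative_Connes_cocycle mul B) :
  exists rt lt : {bilinear A -> A -> A},
    [/\ compatible_anti_dendriform mul rt lt,
        forall x y z : A, B (rt x y) z = - B y (mul z x)
      & forall x y z : A, B (lt x y) z = - B x (mul y z)].
Proof.
have nz2 : 2%:R != 0 :> F by have := charF0 2; rewrite !inE /= => ->.
have [rt rtE] : exists rt : {bilinear A -> A -> A},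
    forall x y z, B (rt x y) z = - B y (mul z x).
  apply: (bilinear_of_form B_nondeg) => [y z|x z|x y] a u v /=.
  - by rewrite linearPr /= linearPr /= opprD mulrN.
  - by rewrite linearPl /= opprD mulrN.
  - by rewrite linearPl /= linearPr /= opprD mulrN.
have [lt ltE] : exists lt : {bilinear A -> A -> A},
    forall x y z, B (lt x y) z = - B x (mul y z).
  apply: (bilinear_of_form B_nondeg) => [y z|x z|x y] a u v /=.
  - by rewrite linearPl /= opprD mulrN.
  - by rewrite linearPl /= linearPr /= opprD mulrN.
  - by rewrite linearPr /= linearPr /= opprD mulrN.
have mulE x y : rt x y + lt x y = mul x y.
  apply: (nondegenerate_injl B_nondeg) => z; rewrite linearDl /= rtE ltE.
  have := B_cocycle x y z.
  rewrite (symmetric_formC B (mul y z)) (symmetric_formC B (mul z x)).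
  by rewrite -addrA => /eqP; rewrite addr_eq0 => /eqP ->; rewrite opprD addrC.
have mulrt x y z w : B (- rt (mul x y) z) w = B z (mul (mul w x) y).
  by rewrite linearNl /= rtE opprK mulA.
have mullt x y z w : B (- lt x (mul y z)) w = B x (mul (mul y z) w).
  by rewrite linearNl /= ltE opprK.
exists rt, lt; split=> //; split=> [|x y]; last by rewrite mulE.
split=> x y z; rewrite ?mulE; apply: (nondegenerate_injl B_nondeg) => w.
- by rewrite mulrt !rtE opprK.
- by rewrite mulrt mullt; apply: (cocycle_rotate2 mulA B_cocycle).
- by rewrite mullt !ltE opprK mulA.
- by rewrite ltE !rtE [in RHS]ltE !opprK mulA.
Qed.
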